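(* Let $\Phi$ be a tight derivation in system $lhd$ of $\Gamma\vdash^{(b,e,r)}t:\tau$, where $t\in\Lambda_{lsc}$ and $\tau$ is a type. Then there exists $p\in\Lambda_{lsc}$ such that $t\to_{lhd}^{b/2+e}p$, $\mathrm{normal}_{lhd}(p)$, and $|p|_{lhd}=r$. Moreover, if $\tau=\mathtt{neutral}$ then $\mathrm{neutral}_{lhd}(p)$.
   Context: Terms of the linear substitution calculus $\Lambda_{lsc}$: $t,p,u,v::=x\mid\lambda x.t\mid t\,p\mid t[x\backslash p]$, where $t[x\backslash p]$ is an explicit substitution (ES) binding $x$ in $t$; $\mathrm{fv}(t[x\backslash p])=(\mathrm{fv}(t)\setminus\{x\})\cup\mathrm{fv}(p)$. Terms are up to $\alpha$-equivalence. Substitution contexts $L::=\langle\cdot\rangle\mid L[x\backslash t]$; linear head contexts $H::=\langle\cdot\rangle\mid\lambda x.H\mid H\,t\mid H[x\backslash t]$. $L\langle t\rangle$, $H\langle t\rangle$ denote plugging (possibly capturing variables); $H\langle\!\langle t\rangle\!\rangle$ denotes plugging where $H$ does not capture free variables of $t$. $\mathrm{abs}_{lhd}$: $\mathrm{abs}_{lhd}(\lambda x.t)$; $\mathrm{abs}_{lhd}(t[x\backslash p])$ if $\mathrm{abs}_{lhd}(t)$. Predicates (inductive): $\mathrm{neutral}^x(x)$; $\mathrm{neutral}^x(t\,p)$ if $\mathrm{neutral}^x(t)$; $\mathrm{neutral}^x(t[y\backslash p])$ if $\mathrm{neutral}^x(t)$ and $y\neq x$. $\mathrm{normal}^x(t)$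 if $\mathrm{neutral}^x(t)$; $\mathrm{normal}^x(\lambda y.t)$ if $\mathrm{normal}^x(t)$ and $y\neq x$; $\mathrm{normal}^x(t[y\backslash p])$ if $\mathrm{normal}^x(t)$ and $y\neq x$. $\mathrm{normal}^\#(\lambda x.t)$ if $\mathrm{normal}^x(t)$; $\mathrm{normal}^\#(\lambda x.t)$ if $\mathrm{normal}^\#(t)$; $\mathrm{normal}^\#(t[y\backslash p])$ if $\mathrm{normal}^\#(t)$. Finally $\mathrm{normal}_{lhd}(t)$ iff $\mathrm{normal}^x(t)$ for some $x$ or $\mathrm{normal}^\#(t)$; $\mathrm{neutral}_{lhd}(t)$ iff $\mathrm{neutral}^x(t)$ for some $x$. Evaluation $\to_{lhd}$ (inductive; up to $\alpha$, so that variables bound by $L$ are not free in $u$): (m) $L\langle\lambda x.t\rangle u\to_{lhd}L\langle t[x\backslash u]\rangle$; (e) $H\langle\!\langle x\rangle\!\rangle[x\backslash t]\to_{lhd}H\langle\!\langle t\rangle\!\rangle[x\backslash t]$; closure: $\lambda x.t\to_{lhd}\lambda x.u$ if $t\to_{lhd}u$; $t\,v\to_{lhd}u\,v$ if $t\to_{lhd}u$ and not $\mathrm{abs}_{lhd}(t)$; $t[x\backslash v]\to_{lhd}u[x\backslash v]$ if $t\to_{lhd}u$ and $t$ is not of the form $H\langle\!\langle x\rangle\!\rangle$. $\to_{lhd}^k$ is $k$-fold iteration (writing $b/2+e$ entails it is a natural number). Size: $|x|_{lhd}=1$; $|\lambda x.t|_{lhd}=|t|_{lhd}+1$; $|t\,u|_{lhd}=|t|_{lhd}+1$;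 $|t[x\backslash u]|_{lhd}=|t|_{lhd}$. Types: tight constants are $\mathtt{neutral}$ and $\mathtt{abs}$ (generically $\mathtt{tight}$); types $\tau,\sigma::=\mathtt{tight}\mid X\mid M\to\tau$, with $X$ in a non-empty set of atomic types; $M::=[\tau_i]_{i\in I}$ ($I$ finite) are finite multisets, $[\,]$ the empty one, $|M|$ the cardinality. A type is tight if it is a tight constant; a multiset is tight if all its elements are. A typing context $\Gamma$ maps variables to multisets, all but finitely many to $[\,]$; it is tight if every $\Gamma(x)$ is. $\uplus$ is multiset union, pointwise on contexts. $\Gamma;x:M$ is the extension of $\Gamma$ (with $\Gamma(x)=[\,]$) mapping $x$ to $M$ ($M$ possibly empty). Typing rules of system $lhd$: (ax) $x:[\tau]\vdash^{(0,0,1)}x:\tau$. (many) from $(\Delta_i\vdash^{(b_i,e_i,r_i)}t:\tau_i)_{i\in I}$, $I$ finite, possibly empty, infer $\uplus_i\Delta_i\vdash^{(\sum b_i,\sum e_i,\sum r_i)}t:[\tau_i]_{i\in I}$. (fun$_b$) from $\Gamma;x:M\vdash^{(b,e,r)}t:\tau$ infer $\Gamma\vdash^{(b+1,e+|M|,r-|M|)}\lambda x.t:M\to\tau$. (fun$_r$) from $\Gamma;x:M\vdash^{(b,e,r)}t:\mathtt{tight}$ with $M$ tight infer $\Gamma\vdash^{(b,e,r+1)}\lambda x.t:\mathtt{abs}$. (app$_b$) from $\Gamma\vdash^{(b,e,r)}t:M\to\tau$ and $\Delta\vdash^{(b',e',r')}p:M$ infer $\Gamma\uplus\Delta\vdash^{(b+b'+1,e+e',r+r')}t\,p:\tau$.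 (app$_r$) from $\Gamma\vdash^{(b,e,r)}t:\mathtt{neutral}$ infer $\Gamma\vdash^{(b,e,r+1)}t\,u:\mathtt{neutral}$ ($u$ arbitrary). (ES) from $\Gamma;x:M\vdash^{(b,e,r)}t:\tau$ and $\Delta\vdash^{(b',e',r')}u:M$ infer $\Gamma\uplus\Delta\vdash^{(b+b',e+e'+|M|,r+r'-|M|)}t[x\backslash u]:\tau$. A derivation of $\Gamma\vdash^{(b,e,r)}t:\tau$ is tight if $\tau$ and $\Gamma$ are tight. *)

(* Defs.v *)
From mathcomp Require Import all_boot.

Set Implicit Arguments.
Unset Strict Implicit.
Unset Printing Implicit Defensive.

(* Terms of the linear substitution calculus up to alpha-equivalence, with
   de Bruijn indices: [Lam t] and [ES t p] (written t[x\p] on paper) bind the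
   index 0 in [t]; [ES t p] binds nothing in [p]. *)
Inductive term : Type :=
| Var of nat
| Lam of term
| App of term & term
| ES of term & term.

(* [shift k c t] adds k to the free indices of t that are at least c. *)
Fixpoint shift (k c : nat) (t : term) : term :=
  match t with
  | Var x => Var (if x < c then x else x + k)
  | Lam u => Lam (shift k c.+1 u)
  | App u p => App (shift k c u) (shift k c p)
  | ES u p => ES (shift k c.+1 u) (shift k c p)
  end.

Inductive subst_ctx : Type :=
| SHole
| SES of subst_ctx & term.

Fixpoint splug (L : subst_ctx) (t : term) : term :=
  match L with
  | SHole => t
  | SES L' p => ES (splug L' t) p
  end.

Fixpoint sdepth (L : subst_ctx) : nat :=
  match L with
  | SHole => 0
  | SES L' _ => (sdepth L').+1
  end.

Inductive head_ctx : Type :=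
| HHole
| HLam of head_ctx
| HApp of head_ctx & term
| HES of head_ctx & term.

Fixpoint hplug (H : head_ctx) (t : term) : term :=
  match H with
  | HHole => t
  | HLam H' => Lam (hplug H' t)
  | HApp H' p => App (hplug H' t) p
  | HES H' p => ES (hplug H' t) p
  end.

Fixpoint hdepth (H : head_ctx) : nat :=
  match H with
  | HHole => 0
  | HLam H' => (hdepth H').+1
  | HApp H' _ => hdepth H'
  | HES H' _ => (hdepth H').+1
  end.

(* Plugging without capture, H<<t>>: here t lives outside the binders of H. *)
Definition hplug_nc (H : head_ctx) (t : term) : term :=
  hplug H (shift (hdepth H) 0 t).

Inductive abs_lhd : term -> Prop :=
| abs_lam t : abs_lhd (Lam t)
| abs_ES t p : abs_lhd t -> abs_lhd (ES t p).

(* Under a binder the variable x becomes x.+1, which makes the side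
   conditions y <> x automatic. *)
Inductive neutral_var : nat -> term -> Prop :=
| neutral_Var x : neutral_var x (Var x)
| neutral_App x t p : neutral_var x t -> neutral_var x (App t p)
| neutral_ES x t p : neutral_var x.+1 t -> neutral_var x (ES t p).

Inductive normal_var : nat -> term -> Prop :=
| normal_neutral x t : neutral_var x t -> normal_var x t
| normal_Lam x t : normal_var x.+1 t -> normal_var x (Lam t)
| normal_ES x t p : normal_var x.+1 t -> normal_var x (ES t p).

Inductive normal_sharp : term -> Prop :=
| sharp_Lam_var t : normal_var 0 t -> normal_sharp (Lam t)
| sharp_Lam t : normal_sharp t -> normal_sharp (Lam t)
| sharp_ES t p : normal_sharp t -> normal_sharp (ES t p).

Definition normal_lhd (t : term) : Prop :=
  (exists x, normal_var x t) \/ normal_sharp t.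

Definition neutral_lhd (t : term) : Prop := exists x, neutral_var x t.

Inductive step : term -> term -> Prop :=
| step_m L t u :
    step (App (splug L (Lam t)) u)
         (splug L (ES t (shift (sdepth L) 0 u)))
| step_e H t :
    step (ES (hplug_nc H (Var 0)) t)
         (ES (hplug_nc H (shift 1 0 t)) t)
| step_Lam t u : step t u -> step (Lam t) (Lam u)
| step_App t u v : step t u -> ~ abs_lhd t -> step (App t v) (App u v)
| step_ES t u v :
    step t u -> ~ (exists H, t = hplug_nc H (Var 0)) ->
    step (ES t v) (ES u v).

Fixpoint steps (k : nat) (t p : term) : Prop :=
  if k is k'.+1 then exists2 u, step t u & steps k' u p else t = p.

Fixpoint size_lhd (t : term) : nat :=
  match t with
  | Var _ => 1
  | Lam u => (size_lhd u).+1
  | App u _ => (size_lhd u).+1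
  | ES u _ => size_lhd u
  end.

Inductive tight_const : Type := Neutral | Abs.

(* Multisets are represented by sequences, and are identified by [meq]. *)
Inductive ty (A : Type) : Type :=
| Tight of tight_const
| Atom of A
| Arr of seq (ty A) & ty A.

Arguments Tight {A} _.

(* Equality of types, resp. of multisets of types: equality up to
   reordering of the multisets at every depth. *)
Inductive teq {A : Type} : ty A -> ty A -> Prop :=
| teq_Tight c : teq (Tight c) (Tight c)
| teq_Atom a : teq (Atom a) (Atom a)
| teq_Arr M N tau sigma :
    meq M N -> teq tau sigma -> teq (Arr M tau) (Arr N sigma)
with meq {A : Type} : seq (ty A) -> seq (ty A) -> Prop :=
| meq_nil : meq [::] [::]
| meq_cons tau sigma M N :
    teq tau sigma -> meq M N -> meq (tau :: M) (sigma :: N)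
| meq_swap tau sigma M : meq (tau :: sigma :: M) (sigma :: tau :: M)
| meq_trans M N P : meq M N -> meq N P -> meq M P.

Definition is_tight {A : Type} (tau : ty A) : bool :=
  if tau is Tight _ then true else false.

(* Finiteness of the support is not required here: it holds for every
   derivable judgment, see [typing_finite] below. *)
Definition ctx (A : Type) : Type := nat -> seq (ty A).

Definition ceq {A : Type} (G D : ctx A) : Prop := forall x, meq (G x) (D x).

Definition is_tight_ctx {A : Type} (G : ctx A) : Prop :=
  forall x, all is_tight (G x).

Definition cempty {A : Type} : ctx A := fun=> [::].

Definition csingle {A : Type} (x : nat) (tau : ty A) : ctx A :=
  fun y => if y == x then [:: tau] else [::].

Definition cunion {A : Type} (G D : ctx A) : ctx A := fun x => G x ++ D x.

(* The extension (Gamma; x : M), for the variable x bound by the next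
   enclosing binder. *)
Definition cext {A : Type} (M : seq (ty A)) (G : ctx A) : ctx A :=
  fun x => if x is y.+1 then G y else M.

(* The rule (many) is [many_nil]/[many_cons], adding the premises one by one.
   The rules [typing_eq] and [mtyping_eq] express that judgments are about
   multisets rather than sequences.
   The subtractions are exact, see [typing_r_ge] below. *)
Inductive typing {A : Type} :
    ctx A -> nat -> nat -> nat -> term -> ty A -> Prop :=
| typing_ax x tau : typing (csingle x tau) 0 0 1 (Var x) tau
| typing_fun_b G M b e r t tau :
    typing (cext M G) b e r t tau ->
    typing G (b + 1) (e + size M) (r - size M) (Lam t) (Arr M tau)
| typing_fun_r G M b e r t c :
    typing (cext M G) b e r t (Tight c) -> all is_tight M ->
    typing G b e (r + 1) (Lam t) (Tight Abs)
| typing_app_b G D M b e r b' e' r' t p tau :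
    typing G b e r t (Arr M tau) -> mtyping D b' e' r' p M ->
    typing (cunion G D) (b + b' + 1) (e + e') (r + r') (App t p) tau
| typing_app_r G b e r t u :
    typing G b e r t (Tight Neutral) ->
    typing G b e (r + 1) (App t u) (Tight Neutral)
| typing_ES G D M b e r b' e' r' t u tau :
    typing (cext M G) b e r t tau -> mtyping D b' e' r' u M ->
    typing (cunion G D) (b + b') (e + e' + size M) (r + r' - size M)
           (ES t u) tau
| typing_eq G G' b e r t tau tau' :
    typing G b e r t tau -> ceq G G' -> teq tau tau' ->
    typing G' b e r t tau'
with mtyping {A : Type} :
    ctx A -> nat -> nat -> nat -> term -> seq (ty A) -> Prop :=
| many_nil t : mtyping cempty 0 0 0 t [::]
| many_cons G D b e r b' e' r' t tau M :
    typing G b e r t tau -> mtyping D b' e' r' t M ->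
    mtyping (cunion G D) (b + b') (e + e') (r + r') t (tau :: M)
| mtyping_eq G G' b e r t M M' :
    mtyping G b e r t M -> ceq G G' -> meq M M' ->
    mtyping G' b e r t M'.

Scheme typing_mut := Minimality for typing Sort Prop
with mtyping_mut := Minimality for mtyping Sort Prop.
Combined Scheme typing_mtyping_ind from typing_mut, mtyping_mut.

Lemma meq_size (A : Type) (M N : seq (ty A)) : meq M N -> size M = size N.
Proof. by elim=> //= [? ? ? ? _ _ -> | ? ? ? _ -> _ ->]. Qed.

Definition csize {A : Type} (n : nat) (G : ctx A) : nat :=
  \sum_(x < n) size (G x).

Lemma csize_cext (A : Type) n (M : seq (ty A)) G :
  csize n.+1 (cext M G) = size M + csize n G.
Proof. by rewrite /csize big_ord_recl. Qed.

Lemma csize_cunion (A : Type) n (G D : ctx A) :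
  csize n (cunion G D) = csize n G + csize n D.
Proof.
by rewrite /csize -big_split; apply: eq_bigr => i _; rewrite size_cat.
Qed.

Lemma csize_ceq (A : Type) n (G D : ctx A) : ceq G D -> csize n G = csize n D.
Proof. by move=> GD; apply: eq_bigr => i _; apply: meq_size. Qed.

Lemma csize_csingle (A : Type) n x (tau : ty A) : csize n (csingle x tau) <= 1.
Proof.
elim: n => [|n IHn] in x *; first by rewrite /csize big_ord0.
rewrite /csize big_ord_recl; case: x => [|x].
  by rewrite big1 ?addn0.
by rewrite (eq_bigr (fun i : 'I_n => size (csingle x tau i))) ?IHn.
Qed.

Lemma typing_csize (A : Type) :
  (forall (G : ctx A) b e r t tau,
     typing G b e r t tau -> forall n, csize n G <= r) /\
  (forall (G : ctx A) b e r t M,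
     mtyping G b e r t M -> forall n, csize n G <= r).
Proof.
apply: typing_mtyping_ind.
- by move=> x tau n; apply: csize_csingle.
- move=> G M b e r t tau _ IH n; have := IH n.+1.
  by rewrite csize_cext => le_r; rewrite leq_subRL ?(leq_trans (leq_addr _ _) le_r).
- move=> G M b e r t c _ IH _ n; have := IH n.+1.
  by rewrite csize_cext addn1 => le_r; rewrite leqW ?(leq_trans (leq_addl _ _) le_r).
- move=> G D M b e r b' e' r' t p tau _ IH _ IH' n.
  by rewrite csize_cunion leq_add // IH'.
- by move=> G b e r t u _ IH n; rewrite addn1 leqW.
- move=> G D M b e r b' e' r' t u tau _ IH _ IH' n.
  have := leq_add (IH n.+1) (IH' n).
  rewrite csize_cext csize_cunion -addnA => le_r.
  by rewrite leq_subRL ?(leq_trans (leq_addr _ _) le_r).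
- by move=> G G' b e r t tau tau' _ IH GG' _ n; rewrite -(csize_ceq _ GG').
- by move=> t n; rewrite /csize big1.
- move=> G D b e r b' e' r' t tau M _ IH _ IH' n.
  by rewrite csize_cunion leq_add // IH'.
- move=> G G' b e r t M M' _ IH GG' _ n.
  by rewrite -(csize_ceq _ GG').
Qed.

(* In (fun_b) and (ES), the number r of the premise is at least |M|. *)
Lemma typing_r_ge (A : Type) M (G : ctx A) b e r t tau :
  typing (cext M G) b e r t tau -> size M <= r.
Proof.
move=> /(typing_csize A).1 /(_ 1).
by rewrite csize_cext => le_r; rewrite (leq_trans (leq_addr _ _) le_r).
Qed.

Definition cfinite {A : Type} (G : ctx A) : Prop :=
  exists n, forall x, n <= x -> G x = [::].

Lemma cfinite_cext (A : Type) M (G : ctx A) : cfinite (cext M G) -> cfinite G.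
Proof. by case=> n Gn; exists n => x le_nx; apply: (Gn x.+1); apply: leqW. Qed.

Lemma cfinite_cunion (A : Type) (G D : ctx A) :
  cfinite G -> cfinite D -> cfinite (cunion G D).
Proof.
move=> [n Gn] [m Dm]; exists (maxn n m) => x.
by rewrite geq_max /cunion => /andP[/Gn-> /Dm->].
Qed.

Lemma cfinite_ceq (A : Type) (G D : ctx A) : ceq G D -> cfinite G -> cfinite D.
Proof.
move=> GD [n Gn]; exists n => x le_nx.
by apply/size0nil; rewrite -(meq_size (GD x)) Gn.
Qed.

Lemma typing_finite (A : Type) (G : ctx A) b e r t tau :
  typing G b e r t tau -> cfinite G.
Proof.
move: G b e r t tau.
suff [] : (forall (G : ctx A) b e r t tau,
             typing G b e r t tau -> cfinite G) /\
          (forall (G : ctx A) b e r t M,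
             mtyping G b e r t M -> cfinite G) by [].
apply: typing_mtyping_ind => //; do ?by move=> *; apply: cfinite_cunion.
- move=> x tau; exists x.+1 => y; rewrite /csingle.
  by case: eqP => // ->; rewrite ltnn.
- by move=> G M b e r t tau _ /cfinite_cext.
- by move=> G M b e r t c _ /cfinite_cext.
- by move=> G D M b e r b' e' r' t u tau _ /cfinite_cext ? _; apply: cfinite_cunion.
- by move=> G G' b e r t tau tau' _ ? /cfinite_ceq GG' _; apply: GG'.
- by move=> t; exists 0.
- by move=> G G' b e r t M M' _ ? /cfinite_ceq GG' _; apply: GG'.
Qed.

(* Main.v *)
Require Import Defs.
From mathcomp Require Import all_boot.
From mathcomp Require Import zify.

Set Implicit Arguments.
Unset Strict Implicit.
Unset Printing Implicit Defensive.

(** Every step preserves typability, tight or not, and keeps r: contracting a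
beta-redex erases one application rule and one abstraction rule, so b drops by
2; replacing the head occurrence of x in [H<<x>>[x\t]] moves one element of the
multiset of x from the argument to the hole, so e drops by 1. Every term is
normal or takes a step. A tight derivation of a normal form types nothing
but its spine, so that b = e = 0 and r is the size. *)

(* Types and multisets up to reordering *)
Scheme teq_mut := Minimality for teq Sort Prop
with meq_mut := Minimality for meq Sort Prop.
Combined Scheme teq_meq_ind from teq_mut, meq_mut.

Section Typing.
Variable A : Type.
Implicit Types (tau sigma : ty A) (M N P Q : seq (ty A)) (G D : ctx A).

(** [ty] is nested through [seq], so its generated induction principle says nothing about the
    elements of a multiset; the inner fixpoint supplies the recursive calls on them. *)
Fixpoint teq_refl tau : teq tau tau :=
  match tau with
  | Tight c => teq_Tight c
  | Atom a => teq_Atom a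
  | Arr M sigma =>
      teq_Arr
        ((fix meq_refl' N : meq N N :=
            match N with
            | [::] => meq_nil
            | rho :: N' => meq_cons (teq_refl rho) (meq_refl' N')
            end) M)
        (teq_refl sigma)
  end.

Lemma meq_refl M : meq M M.
Proof. by elim: M => [|tau M IH]; constructor=> //; apply: teq_refl. Qed.

Lemma teq_meq_sym :
  (forall tau sigma, teq tau sigma -> teq sigma tau) /\
  (forall M N, meq M N -> meq N M).
Proof.
apply: teq_meq_ind => [c|a|M N tau sigma _ NM _ ts||tau sigma M N _ ts _ NM|
  tau sigma M|M N P _ NM _ PN]; try by constructor.
exact: meq_trans PN NM.
Qed.

Definition meq_sym M N : meq M N -> meq N M := teq_meq_sym.2 M N.

(** Multisets are already transitive by a constructor, so the non-mutual induction on [teq] is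
    enough. *)
Lemma teq_trans tau sigma rho : teq tau sigma -> teq sigma rho -> teq tau rho.
Proof.
move=> ts; elim: ts rho => // {tau sigma} M N tau sigma MN _ IH rho sr.
inversion sr; subst; constructor; [exact: meq_trans MN _ | exact: IH].
Qed.

Lemma meq_cat M N P Q : meq M N -> meq P Q -> meq (M ++ P) (N ++ Q).
Proof.
move=> MN PQ; apply: (@meq_trans _ _ (N ++ P)).
  elim: MN => [|tau sigma {}M {}N ts _ IH|tau sigma {}M|{}M {}N R _ IH1 _ IH2] /=.
  - exact: meq_refl.
  - exact: meq_cons.
  - exact: meq_swap.
  - exact: meq_trans IH1 IH2.
elim: N {MN} => //= tau N IH; apply: meq_cons IH; exact: teq_refl.
Qed.

Lemma meq_middle M tau N : meq (M ++ tau :: N) (tau :: M ++ N).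
Proof.
elim: M => [|sigma M IH] /=; first exact: meq_refl.
by apply: meq_trans (meq_swap _ _ _); apply: meq_cons => //; apply: teq_refl.
Qed.

Lemma meq_catC M N : meq (M ++ N) (N ++ M).
Proof.
elim: M => [|tau M IH] /=; first by rewrite cats0; apply: meq_refl.
apply: meq_trans (meq_sym (meq_middle _ _ _)).
by apply: meq_cons => //; apply: teq_refl.
Qed.

Lemma meq_catAC M N P : meq ((M ++ N) ++ P) ((M ++ P) ++ N).
Proof.
by rewrite -!catA; apply: meq_cat (meq_refl _) (meq_catC _ _).
Qed.

(** Inversion is blocked by the constructor [meq_trans]. Following one marked occurrence of [N] back
    to [M] is a property that composes along transitivity, so induction on [meq] proves it. *)
Lemma meq_split M N : meq M N ->
  forall P sigma Q, N = P ++ sigma :: Q ->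
  exists P' tau Q', [/\ M = P' ++ tau :: Q', teq tau sigma
                      & meq (P' ++ Q') (P ++ Q)].
Proof.
elim=> {M N} [|tau sigma M N ts MN IH|tau sigma M|M N R _ IH1 _ IH2] P rho Q.
- by case: P.
- case: P => [|x P] /= [? defN]; subst.
    by exists [::], tau, M.
  have [P' [tau' [Q' [-> tr eqPQ]]]] := IH _ _ _ (erefl _).
  by exists (tau :: P'), tau', Q'; split=> //=; apply: meq_cons.
(* The marked element stands first, second, or beyond the swapped pair. *)
- case: P => [|x [|y P]] /= [? ?]; first (move=> ? || idtac); subst.
  + exists [:: tau], rho, M; split=> //=; [exact: teq_refl|exact: meq_refl].
  + move=> *; subst.
    exists [::], rho, (x :: Q); split=> //=; [exact: teq_refl|exact: meq_refl].
  + move=> *; subst.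
    by exists (y :: x :: P), rho, Q; split=> //=; [exact: teq_refl|exact: meq_swap].
- move=> /IH2 [P1 [tau1 [Q1 [/IH1 [P2 [tau2 [Q2 [-> t21 eq2]]]] t1 eq1]]]].
  exists P2, tau2, Q2; split=> //; first exact: teq_trans t21 t1.
  exact: meq_trans eq2 eq1.
Qed.

Lemma teq_is_tight tau sigma : teq tau sigma -> is_tight tau = is_tight sigma.
Proof. by case. Qed.

Lemma meq_all_tight M N : meq M N -> all is_tight M = all is_tight N.
Proof.
elim=> //= [tau sigma {}M {}N /teq_is_tight-> _ -> //|tau sigma {}M|].
  by rewrite andbCA.
by move=> {}M {}N P _ -> _ ->.
Qed.

Lemma teq_TightE c tau : teq (Tight c) tau -> tau = Tight c.
Proof. by move=> ct; inversion ct. Qed.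

Lemma teq_Arr_inv M N tau sigma :
  teq (Arr M tau) (Arr N sigma) -> meq M N /\ teq tau sigma.
Proof. by move=> eqt; inversion eqt. Qed.

(** * Contexts, inversion of judgments, and splitting of multiset derivations *)

Lemma ceq_refl G : ceq G G. Proof. by move=> x; apply: meq_refl. Qed.

Lemma ceq_trans G1 G2 G3 : ceq G1 G2 -> ceq G2 G3 -> ceq G1 G3.
Proof. by move=> G12 G23 x; apply: meq_trans (G12 x) (G23 x). Qed.

Lemma ceq_cext M N G D : meq M N -> ceq G D -> ceq (cext M G) (cext N D).
Proof. by move=> MN GD [|x] //=. Qed.

Lemma ceq_cunion G G' D D' :
  ceq G G' -> ceq D D' -> ceq (cunion G D) (cunion G' D').
Proof. by move=> GG DD x; apply: meq_cat. Qed.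

Lemma cunionAC G1 G2 G3 :
  ceq (cunion (cunion G1 G2) G3) (cunion (cunion G1 G3) G2).
Proof. by move=> x; apply: meq_catAC. Qed.

Lemma ceq_csingle x tau sigma :
  teq tau sigma -> ceq (csingle x tau) (csingle x sigma).
Proof.
move=> ts y; rewrite /csingle; case: ifP => _; last exact: meq_nil.
by apply: meq_cons => //; apply: meq_nil.
Qed.

(** Applying a rule yields a context and counters of a fixed shape; this turns the mismatch into
    side goals on [ceq] and on arithmetic. *)
Lemma typing_cast G G' b b' e e' r r' t tau :
  typing G b e r t tau -> ceq G G' -> b = b' -> e = e' -> r = r' ->
  typing G' b' e' r' t tau.
Proof.
by move=> Gt GG <- <- <-; apply: typing_eq Gt GG (teq_refl _).
Qed.

Lemma mtyping_cast G G' b b' e e' r r' t M :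
  mtyping G b e r t M -> ceq G G' -> b = b' -> e = e' -> r = r' ->
  mtyping G' b' e' r' t M.
Proof.
by move=> Gt GG <- <- <-; apply: mtyping_eq Gt GG (meq_refl _).
Qed.

(** Since [typing_eq] can end any derivation, inversion must absorb a chain of conversions; they are
    collected in [ceq] and [teq]. A tight type is equal only to itself, so there a plain equality
    remains. *)
Lemma typing_inv G b e r t tau : typing G b e r t tau ->
  match t with
  | Var x => [/\ ceq (csingle x tau) G, b = 0, e = 0 & r = 1]
  | Lam t1 =>
      (exists M sigma b1 e1 r1,
         teq (Arr M sigma) tau /\
         [/\ typing (cext M G) b1 e1 r1 t1 sigma,
             b = b1 + 1, e = e1 + size M & r = r1 - size M]) \/
      (exists M c r1,
         [/\ typing (cext M G) b e r1 t1 (Tight c), all is_tight M,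
             tau = Tight Abs & r = r1 + 1])
  | App t1 p =>
      (exists G1 D M b1 e1 r1 b2 e2 r2,
         [/\ ceq (cunion G1 D) G, typing G1 b1 e1 r1 t1 (Arr M tau)
           & mtyping D b2 e2 r2 p M] /\
         [/\ b = b1 + b2 + 1, e = e1 + e2 & r = r1 + r2]) \/
      (exists r1,
         [/\ typing G b e r1 t1 (Tight Neutral), tau = Tight Neutral
           & r = r1 + 1])
  | ES t1 p =>
      exists G1 D M b1 e1 r1 b2 e2 r2,
        [/\ ceq (cunion G1 D) G, typing (cext M G1) b1 e1 r1 t1 tau
          & mtyping D b2 e2 r2 p M] /\
        [/\ b = b1 + b2, e = e1 + e2 + size M & r = r1 + r2 - size M]
  end.
Proof.
elim=> {G b e r t tau}.
- by move=> x tau; split=> //; apply: ceq_refl.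
- move=> G M b e r t tau Gt _; left; exists M, tau, b, e, r.
  by split; [apply: teq_refl | split].
- by move=> G M b e r t c Gt _ tM; right; exists M, c, r.
- move=> G D M b e r b' e' r' t p tau Gt _ Dp; left.
  exists G, D, M, b, e, r, b', e', r'; do 2!split=> //; exact: ceq_refl.
- by move=> G b e r t u Gt _; right; exists r.
- move=> G D M b e r b' e' r' t p tau Gt _ Dp.
  exists G, D, M, b, e, r, b', e', r'; do 2!split=> //; exact: ceq_refl.
- move=> G G' b e r [x|t|t p|t p] tau tau' _ IH GG tt.
  + case: IH => xG -> -> ->; split=> //.
    have ts := teq_meq_sym.1 _ _ tt.
    exact: ceq_trans (ceq_csingle _ ts) (ceq_trans xG GG).
  + case: IH => [[M [sigma [b1 [e1 [r1 [eqt [Mt -> -> ->]]]]]]]|].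
      left; exists M, sigma, b1, e1, r1; split; first exact: teq_trans eqt tt.
      by split=> //; apply: typing_cast Mt (ceq_cext (meq_refl _) GG) _ _ _.
    move=> [M [c [r1 [Mt tM eqt ->]]]]; right; exists M, c, r1; split=> //.
      exact: typing_cast Mt (ceq_cext (meq_refl _) GG) _ _ _.
    by apply: teq_TightE; rewrite -eqt.
  + case: IH => [[G1 [D [M [b1 [e1 [r1 [b2 [e2 [r2 [[GD Gt Dp] eqs]]]]]]]]]]|].
      left; exists G1, D, M, b1, e1, r1, b2, e2, r2; do 2!split=> //.
        exact: ceq_trans GD GG.
      by apply: typing_eq Gt (ceq_refl _) (teq_Arr (meq_refl _) tt).
    move=> [r1 [Gt eqt ->]]; right; exists r1; split=> //.
      exact: typing_cast Gt GG _ _ _.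
    by apply: teq_TightE; rewrite -eqt.
  + case: IH => [G1 [D [M [b1 [e1 [r1 [b2 [e2 [r2 [[GD Gt Dp] eqs]]]]]]]]]].
    exists G1, D, M, b1, e1, r1, b2, e2, r2; do 2!split=> //.
      exact: ceq_trans GD GG.
    exact: typing_eq Gt (ceq_refl _) tt.
Qed.

(** This detaches the one premise of (many) that types the copy of the argument sent to the head;
    [meq_split] tracks its position through reorderings. *)
Lemma mtyping_split D b e r t M : mtyping D b e r t M ->
  forall P sigma Q, M = P ++ sigma :: Q ->
  exists D1 b1 e1 r1 D2 b2 e2 r2,
    [/\ ceq (cunion D1 D2) D, typing D1 b1 e1 r1 t sigma
      & mtyping D2 b2 e2 r2 t (P ++ Q)] /\
    [/\ b = b1 + b2, e = e1 + e2 & r = r1 + r2].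
Proof.
elim=> {D b e r t M} [t|G D b e r b' e' r' t tau M Gt Dt IH|
    G G' b e r t M M' _ IH GG MM] P sigma Q.
- by case: P.
- case: P => [|x P] /= [? defM]; subst.
    exists G, b, e, r, D, b', e', r'; do 2!split=> //; exact: ceq_refl.
  have [D1 [b1 [e1 [r1 [D2 [b2 [e2 [r2 [[DD D1t D2t] [-> -> ->]]]]]]]]]] :=
    IH _ _ _ (erefl _).
  exists D1, b1, e1, r1, (cunion G D2), (b + b2), (e + e2), (r + r2).
  split; last by split; lia.
  split=> //; last exact: many_cons.
  move=> y; rewrite /cunion catA; apply: meq_trans (meq_cat (meq_refl _) (DD y)).
  by rewrite /cunion catA; apply: meq_cat (meq_catC _ _) (meq_refl _).
- move=> /(meq_split MM) [P' [tau [Q' [defM ts eqPQ]]]].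
  have [D1 [b1 [e1 [r1 [D2 [b2 [e2 [r2 [[DD D1t D2t] eqs]]]]]]]]] :=
    IH _ _ _ defM.
  exists D1, b1, e1, r1, D2, b2, e2, r2; split=> //; split.
  + exact: ceq_trans DD GG.
  + exact: typing_eq D1t (ceq_refl _) ts.
  + exact: mtyping_eq D2t (ceq_refl _) eqPQ.
Qed.

Lemma mtyping_nil D b e r t M : mtyping D b e r t M -> size M = 0 ->
  [/\ forall x, D x = [::], b = 0, e = 0 & r = 0].
Proof.
elim=> // {D b e r t M} G G' b e r t M M' _ IH GG MM sM'.
have [G0 -> -> ->] := IH (etrans (meq_size MM) sM').
by split=> // x; apply/size0nil; rewrite -(meq_size (GG x)) G0.
Qed.

(** * Shifting of derivations *)

(** The weakening that accompanies [shift k c]: the inserted variables do not occur in the term, so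
    they carry empty multisets. *)
Definition cshift (k c : nat) G : ctx A :=
  fun x => if x < c then G x else if x < c + k then [::] else G (x - k).

Lemma cshift_cext k c M G :
  ceq (cshift k c.+1 (cext M G)) (cext M (cshift k c G)).
Proof.
case=> [|x] /=; rewrite /cshift; first exact: meq_refl.
rewrite ltnS addSn ltnS; case: ltnP => _ /=; first exact: meq_refl.
case: ltnP => le_x; first exact: meq_refl.
by rewrite subSn /=; [apply: meq_refl | lia].
Qed.

Lemma cshift_ceq k c G D : ceq G D -> ceq (cshift k c G) (cshift k c D).
Proof.
move=> GD x; rewrite /cshift; do !case: ifP => _ //; exact: meq_nil.
Qed.

Lemma cshift_cunion k c G D :
  ceq (cunion (cshift k c G) (cshift k c D)) (cshift k c (cunion G D)).
Proof.
by move=> x; rewrite /cshift /cunion; do !case: ifP => _; apply: meq_refl.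
Qed.

Lemma cshift1 G : ceq (cshift 1 0 G) (cext [::] G).
Proof. by case=> [|x]; rewrite /cshift /= ?subn1; apply: meq_refl. Qed.

Lemma typing_mtyping_shift k :
  (forall G b e r t tau, typing G b e r t tau ->
     forall c, typing (cshift k c G) b e r (shift k c t) tau) /\
  (forall G b e r t M, mtyping G b e r t M ->
     forall c, mtyping (cshift k c G) b e r (shift k c t) M).
Proof.
apply: typing_mtyping_ind => /=.
- move=> x tau c; apply: typing_cast (typing_ax _ _) _ _ _ _ => // y.
  suff -> : csingle (if x < c then x else x + k) tau y
            = cshift k c (csingle x tau) y by apply: meq_refl.
  by rewrite /csingle /cshift; do !case: ifP => //; lia.
- move=> G M b e r t tau _ IH c; apply: typing_fun_b.
  exact: typing_cast (IH c.+1) (@cshift_cext _ _ _ _) _ _ _.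
- move=> G M b e r t d _ IH tM c; apply: (@typing_fun_r _ _ M) => //.
  exact: typing_cast (IH c.+1) (@cshift_cext _ _ _ _) _ _ _.
- move=> G D M b e r b' e' r' t p tau _ IH _ IH' c.
  exact: typing_cast (typing_app_b (IH c) (IH' c)) (@cshift_cunion _ _ _ _) _ _ _.
- by move=> G b e r t u _ IH c; apply: typing_app_r.
- move=> G D M b e r b' e' r' t p tau _ IH _ IH' c.
  apply: typing_cast (@cshift_cunion _ _ _ _) _ _ _ => //.
  apply: typing_ES (IH' c).
  exact: typing_cast (IH c.+1) (@cshift_cext _ _ _ _) _ _ _.
- move=> G G' b e r t tau tau' _ IH GG tt c.
  exact: typing_eq (IH c) (cshift_ceq _ _ GG) tt.
- move=> t c; apply: mtyping_cast (many_nil _) _ _ _ _ => // x.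
  by rewrite /cshift /cempty; do !case: ifP => _; apply: meq_nil.
- move=> G D b e r b' e' r' t tau M _ IH _ IH' c.
  exact: mtyping_cast (many_cons (IH c) (IH' c)) (@cshift_cunion _ _ _ _) _ _ _.
- move=> G G' b e r t M M' _ IH GG MM c.
  exact: mtyping_eq (IH c) (cshift_ceq _ _ GG) MM.
Qed.

Lemma typing_shift1 G b e r t tau : typing G b e r t tau ->
  typing (cext [::] G) b e r (shift 1 0 t) tau.
Proof.
move=> /(typing_mtyping_shift 1).1 /(_ 0) Gt.
exact: typing_cast Gt (@cshift1 _) _ _ _.
Qed.

Lemma mtyping_shift1 G b e r t M : mtyping G b e r t M ->
  mtyping (cext [::] G) b e r (shift 1 0 t) M.
Proof.
move=> /(typing_mtyping_shift 1).2 /(_ 0) Gt.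
exact: mtyping_cast Gt (@cshift1 _) _ _ _.
Qed.

Lemma shift0 c t : shift 0 c t = t.
Proof.
elim: t c => [x|t IH|t IHt p IHp|t IHt p IHp] c /=; rewrite ?IH ?IHt ?IHp //.
by rewrite addn0 if_same.
Qed.

Lemma shift_shift k l c t : shift k c (shift l c t) = shift (k + l) c t.
Proof.
elim: t c => [x|t IH|t IHt p IHp|t IHt p IHp] c /=; rewrite ?IH ?IHt ?IHp //.
by congr Var; do !case: ifP; lia.
Qed.

(** * Replacing the head occurrence of a variable *)

(** The counter r bounds the total size of the context. This makes the truncated subtraction of 1
    exact when an axiom is removed from a derivation. *)
Lemma typing_used_gt0 G b e r t tau x :
  typing G b e r t tau -> 0 < size (G x) -> 0 < r.
Proof.
move=> /(typing_csize A).1 /(_ x.+1) le_r Gx.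
apply: leq_trans le_r; rewrite /csize big_ord_recr /=; exact: ltn_addl.
Qed.

(* The hole of a head context is typed exactly once, because it is never inside
an argument. *)
Lemma typing_hplug H x G b e r tau :
  typing G b e r (hplug H (Var (x + hdepth H))) tau ->
  exists sigma G0,
    ceq (cunion (csingle x sigma) G0) G /\
    forall D b' e' r' u, typing D b' e' r' u sigma ->
      typing (cunion G0 D) (b + b') (e + e') (r + r' - 1)
             (hplug H (shift (hdepth H) 0 u)) tau.
Proof.
(* Below a binder the head variable has index [y.+1], so index 0 of [G0] holds the whole multiset
   [M] of the bound variable, and the replacement leaves it intact. *)
have cextS M (G1 : ctx A) y sigma G0 :
    ceq (cunion (csingle y.+1 sigma) G0) (cext M G1) ->
    ceq (cunion (csingle y sigma) (fun z => G0 z.+1)) G1 /\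
    forall D, ceq (cunion G0 (cext [::] D))
                  (cext M (cunion (fun z => G0 z.+1) D)).
  move=> eqG; split=> [z|D [|z]]; first exact: (eqG z.+1).
    by rewrite /cunion /= cats0; apply: (eqG 0).
  exact: meq_refl.
have gt0 (G1 : ctx A) b1 e1 r1 t sigma G0 y rho :
    typing G1 b1 e1 r1 t rho -> ceq (cunion (csingle y sigma) G0) G1 -> 0 < r1.
  move=> Gt eqG; apply: (typing_used_gt0 (x := y)) Gt _.
  by rewrite -(meq_size (eqG y)) /cunion /csingle eqxx.
elim: H x G b e r tau => [|H IH|H IH p|H IH p] x G b e r tau /=.
- rewrite addn0 => /typing_inv [eqG -> -> ->]; exists tau, cempty; split.
    by move=> y; rewrite /cunion cats0; apply: eqG.
  (* The axiom that typed the hole counted 1 in r; this is the 1 subtracted in the statement. *)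
  move=> D b' e' r' u Du; rewrite shift0.
  by apply: typing_cast Du (ceq_refl _) _ _ _; lia.
- rewrite addnS -addSn.
  move=> /typing_inv [[M [sigma [b1 [e1 [r1 [eqt [Mt -> -> ->]]]]]]]|].
    have [rho [G0 [/cextS [eqG eqM] subst]]] := IH _ _ _ _ _ _ Mt.
    have le_r := typing_r_ge Mt.
    exists rho, (fun z => G0 z.+1); split=> // D b' e' r' u Du.
    apply: typing_eq (ceq_refl _) eqt.
    (* The term [u] crosses one more binder: it is shifted by 1 before the induction hypothesis
       applies, and the two shifts merge. *)
    have := subst _ _ _ _ _ (typing_shift1 Du); rewrite shift_shift addn1 => Hu.
    have {}Hu := typing_cast Hu (eqM _) (erefl _) (erefl _) (erefl _).
    by apply: typing_cast (typing_fun_b Hu) (ceq_refl _) _ _ _; lia.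
  move=> [M [c [r1 [Mt tM -> ->]]]].
  have [rho [G0 [eqMG subst]]] := IH _ _ _ _ _ _ Mt.
  have r1_gt0 := gt0 _ _ _ _ _ _ _ _ _ Mt eqMG; move/cextS: eqMG => [eqG eqM].
  exists rho, (fun z => G0 z.+1); split=> // D b' e' r' u Du.
  have := subst _ _ _ _ _ (typing_shift1 Du); rewrite shift_shift addn1 => Hu.
  have {}Hu := typing_cast Hu (eqM _) (erefl _) (erefl _) (erefl _).
  by apply: typing_cast (typing_fun_r Hu tM) (ceq_refl _) _ _ _; lia.
- move=> /typing_inv
    [[G1 [E [M [b1 [e1 [r1 [b2 [e2 [r2 [[GE Gt Ep] [-> -> ->]]]]]]]]]]]|].
    have [rho [G0 [eqG subst]]] := IH _ _ _ _ _ _ Gt.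
    have r1_gt0 := gt0 _ _ _ _ _ _ _ _ _ Gt eqG.
    exists rho, (cunion G0 E); split.
      move=> y; rewrite /cunion catA; apply: meq_trans (GE y).
      exact: meq_cat (eqG y) (meq_refl _).
    move=> D b' e' r' u /subst Hu.
    by apply: typing_cast (typing_app_b Hu Ep) (@cunionAC _ _ _) _ _ _; lia.
  move=> [r1 [Gt -> ->]].
  have [rho [G0 [eqG subst]]] := IH _ _ _ _ _ _ Gt.
  have r1_gt0 := gt0 _ _ _ _ _ _ _ _ _ Gt eqG.
  exists rho, G0; split=> // D b' e' r' u /subst Hu.
  by apply: typing_cast (typing_app_r _ Hu) (ceq_refl _) _ _ _; lia.
- rewrite addnS -addSn => /typing_inv
    [G1 [E [M [b1 [e1 [r1 [b2 [e2 [r2 [[GE Gt Ep] [-> -> ->]]]]]]]]]]].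
  have [rho [G0 [eqMG subst]]] := IH _ _ _ _ _ _ Gt.
  have r1_gt0 := gt0 _ _ _ _ _ _ _ _ _ Gt eqMG; move/cextS: eqMG => [eqG eqM].
  have le_r := typing_r_ge Gt.
  exists rho, (cunion (fun z => G0 z.+1) E); split.
    move=> y; rewrite /cunion catA; apply: meq_trans (GE y).
    exact: meq_cat (eqG y) (meq_refl _).
  move=> D b' e' r' u Du.
  have := subst _ _ _ _ _ (typing_shift1 Du); rewrite shift_shift addn1 => Hu.
  have {}Hu := typing_cast Hu (eqM _) (erefl _) (erefl _) (erefl _).
  by apply: typing_cast (typing_ES Hu Ep) (@cunionAC _ _ _) _ _ _; lia.
Qed.

(** * Quantitative subject reduction *)

(** An abstraction gets an arrow or [Abs], and an explicit substitution passes on the type of its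
    body. Hence [typing_app_r] never types a beta-redex. *)
Lemma abs_lhd_not_neutral G b e r t :
  abs_lhd t -> ~ typing G b e r t (Tight Neutral).
Proof.
move=> abs_t; elim: abs_t G b e r => {t} [t|t p _ IH] G b e r /typing_inv.
  case=> [[M [sigma [b1 [e1 [r1 [eqt _]]]]]]|[M [c [r1 [_ _ //]]]]].
  by inversion eqt.
by case=> [G1 [D [M [b1 [e1 [r1 [b2 [e2 [r2 [[_ /IH]]]]]]]]]]].
Qed.

Lemma abs_splug L t : abs_lhd (splug L (Lam t)).
Proof. by elim: L => [|L IH p] /=; constructor. Qed.

(** The rules (fun_b) and (ES) correct e and r by the same |M|, so only the 1 that (fun_b) adds to b
    is lost. The conjunct [0 < b] makes the predecessor exact. *)
Lemma typing_beta L G D b e r b' e' r' t u M tau :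
  typing G b e r (splug L (Lam t)) (Arr M tau) -> mtyping D b' e' r' u M ->
  0 < b /\
  typing (cunion G D) (b.-1 + b') (e + e') (r + r')
         (splug L (ES t (shift (sdepth L) 0 u))) tau.
Proof.
elim: L G D b e r b' e' r' u => [|L IH p] G D b e r b' e' r' u /=.
  move=> /typing_inv [[N [sigma [b1 [e1 [r1 [eqt [Gt -> -> ->]]]]]]]|[?[?[?[]//]]]].
  move=> Du; rewrite shift0; split; first by lia.
  have le_r := typing_r_ge Gt; have [NM st] := teq_Arr_inv eqt.
  have sizeNM := meq_size NM.
  have {}Gt := typing_eq Gt (ceq_refl _) st.
  have Du' := mtyping_eq Du (ceq_refl _) (meq_sym NM).
  by apply: typing_cast (typing_ES Gt Du') (ceq_refl _) _ _ _; lia.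
move=> /typing_inv
  [G1 [E [N [b1 [e1 [r1 [b2 [e2 [r2 [[GE Gt Ep] [-> -> ->]]]]]]]]]]] Du.
have [b1_gt0] := IH _ _ _ _ _ _ _ _ _ Gt (mtyping_shift1 Du).
rewrite shift_shift addn1 => Gt'; split; first by lia.
have le_r := typing_r_ge Gt.
have eqN : ceq (cunion (cext N G1) (cext [::] D)) (cext N (cunion G1 D)).
  by case=> [|y]; rewrite /cunion /= ?cats0; apply: meq_refl.
have {}Gt' := typing_cast Gt' eqN (erefl _) (erefl _) (erefl _).
apply: typing_cast (typing_ES Gt' Ep) _ _ _ _; try lia.
exact: ceq_trans (@cunionAC _ _ _) (ceq_cunion GE (ceq_refl _)).
Qed.

(** Reduction takes place at head positions only, and each typing rule types the head subterm
    exactly once, so the decrease at the redex reaches the root unmultiplied. *)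
Lemma subject_reduction t u : step t u ->
  forall G b e r tau, typing G b e r t tau ->
  exists b' e', typing G b' e' r u tau /\
    (b = b'.+2 /\ e = e' \/ b = b' /\ e = e'.+1).
Proof.
elim=> {t u} [L t u|H t|t u _ IH|t u v _ IH _|t u v _ IH _] G b e r tau
  /typing_inv.
- case=> [[G1 [E [M [b1 [e1 [r1 [b2 [e2 [r2 [[GE Gt Ep] [-> -> ->]]]]]]]]]]]|].
    have [b1_gt0 Gt'] := typing_beta Gt Ep.
    exists (b1.-1 + b2), (e1 + e2); split; last by left; lia.
    exact: typing_cast Gt' GE _ _ _.
  by move=> [r1 [/(abs_lhd_not_neutral (abs_splug _ _))]].
- move=> [G1 [E [M [b1 [e1 [r1 [b2 [e2 [r2 [[GE Gt Ep] [-> -> ->]]]]]]]]]]].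
  have le_r := typing_r_ge Gt.
  have [sigma [G0 [eqG subst]]] := typing_hplug (x := 0) Gt.
  (* Up to reordering, [M] is [sigma :: G0 0]: the new substitution has multiset [G0 0], one element
     fewer, which is the drop in e. In r, the lost axiom is balanced by subtracting one element
     less. *)
  have sizeM := meq_size (eqG 0); rewrite /= in sizeM.
  have Ep' := mtyping_eq Ep (ceq_refl _) (meq_sym (eqG 0)).
  have [D1 [b3 [e3 [r3 [D2 [b4 [e4 [r4 [[DD D1t D2t] [-> -> ->]]]]]]]]]] :=
    mtyping_split Ep' (P := [::]) (erefl _).
  have := subst _ _ _ _ _ (typing_shift1 D1t).
  have eqM : ceq (cunion G0 (cext [::] D1))
                 (cext (G0 0) (cunion (fun z => G0 z.+1) D1)).
    by case=> [|y]; rewrite /cunion /= ?cats0; apply: meq_refl.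
  move=> /typing_cast /(_ eqM (erefl _) (erefl _) (erefl _)) Ht.
  exists (b1 + b3 + b4), (e1 + e3 + e4 + size (G0 0)).
  split; last by right; lia.
  apply: typing_cast (typing_ES Ht D2t) _ _ _ _; try lia.
  move=> y; apply: meq_trans (GE y); rewrite /cunion -catA.
  exact: meq_cat (eqG y.+1) (DD y).
- case=> [[M [sigma [b1 [e1 [r1 [eqt [Mt -> -> ->]]]]]]]|].
    have [b' [e' [Mu eqs]]] := IH _ _ _ _ _ Mt.
    exists (b' + 1), (e' + size M); split; last by lia.
    exact: typing_eq (typing_fun_b Mu) (ceq_refl _) eqt.
  move=> [M [c [r1 [Mt tM -> ->]]]].
  have [b' [e' [Mu eqs]]] := IH _ _ _ _ _ Mt.
  by exists b', e'; split=> //; apply: typing_fun_r Mu tM.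
- case=> [[G1 [E [M [b1 [e1 [r1 [b2 [e2 [r2 [[GE Gt Ep] [-> -> ->]]]]]]]]]]]|].
    have [b' [e' [Gu eqs]]] := IH _ _ _ _ _ Gt.
    exists (b' + b2 + 1), (e' + e2); split; last by lia.
    exact: typing_cast (typing_app_b Gu Ep) GE _ _ _.
  move=> [r1 [Gt -> ->]].
  have [b' [e' [Gu eqs]]] := IH _ _ _ _ _ Gt.
  by exists b', e'; split=> //; apply: typing_app_r.
- move=> [G1 [E [M [b1 [e1 [r1 [b2 [e2 [r2 [[GE Gt Ep] [-> -> ->]]]]]]]]]]].
  have [b' [e' [Gu eqs]]] := IH _ _ _ _ _ Gt.
  exists (b' + b2), (e' + e2 + size M); split; last by lia.
  exact: typing_cast (typing_ES Gu Ep) GE _ _ _.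
Qed.

(** * Tight derivations of normal forms *)

(** The head variable takes its type from the tight multiset [G x]. A tight type is no arrow, so
    every application on the spine is typed by (app_r), its argument stays untyped, and [x] is the
    only variable in use. *)
Lemma neutral_var_tight x t : neutral_var x t ->
  forall G b e r tau, typing G b e r t tau -> all is_tight (G x) ->
  [/\ is_tight tau, b = 0, e = 0, r = size_lhd t
    & forall y, y != x -> G y = [::]].
Proof.
elim=> {x t} [x|x t p _ IH|x t p _ IH] G b e r tau /typing_inv /=.
- move=> [eqG -> -> ->]; rewrite -(meq_all_tight (eqG x)) /csingle eqxx /=.
  rewrite andbT => tight_tau; split=> // y /negPf ne_yx; apply: size0nil.
  by rewrite -(meq_size (eqG y)) /csingle ne_yx.
- case=> [[G1 [E [M [b1 [e1 [r1 [b2 [e2 [r2 [[GE Gt Ep] _]]]]]]]]]]|].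
    rewrite -(meq_all_tight (GE x)) all_cat => /andP[tG _].
    by have [] := IH _ _ _ _ _ Gt tG.
  move=> [r1 [Gt -> ->]] tG; have [_ -> -> -> eqG] := IH _ _ _ _ _ Gt tG.
  by split=> //; rewrite addn1.
- move=> [G1 [E [M [b1 [e1 [r1 [b2 [e2 [r2 [[GE Gt Ep] [-> -> ->]]]]]]]]]]].
  rewrite -(meq_all_tight (GE x)) all_cat => /andP[tG _].
  have [tight_tau -> -> -> eqG] := IH _ _ _ _ _ Gt tG.
  (* The variable 0 bound here is not the head variable [x.+1], so the argument is typed zero
     times. *)
  have M0 : M = [::] := eqG 0 isT.
  have [E0 -> -> ->] := mtyping_nil Ep (congr1 size M0).
  rewrite M0; split=> //=; first by lia.
  move=> y ne_yx; apply: size0nil.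
  by rewrite -(meq_size (GE y)) /cunion E0 cats0 [G1 y](eqG y.+1).
Qed.

(** Tightness of [tau] is now a hypothesis: it excludes (fun_b) at an abstraction, and (fun_r) hands
    a tight type to the body. *)
Lemma normal_var_tight x t : normal_var x t ->
  forall G b e r tau, typing G b e r t tau -> all is_tight (G x) ->
  is_tight tau ->
  [/\ b = 0, e = 0, r = size_lhd t & forall y, y != x -> G y = [::]].
Proof.
elim=> {x t} [x t ntr|x t _ IH|x t p _ IH] G b e r tau.
- by move=> Gt tG _; have [] := neutral_var_tight ntr Gt tG.
- case/typing_inv=> [[M [sigma [b1 [e1 [r1 [eqt _]]]]]]|].
    by rewrite -(teq_is_tight eqt).
  move=> [M [c [r1 [Mt tM -> ->]]]] tG _.
  have [-> -> -> eqG] := IH _ _ _ _ _ Mt tG isT.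
  by split; rewrite ?addn1 // => y ne_yx; apply: (eqG y.+1).
- move=> /typing_inv
    [G1 [E [M [b1 [e1 [r1 [b2 [e2 [r2 [[GE Gt Ep] [-> -> ->]]]]]]]]]]].
  rewrite -(meq_all_tight (GE x)) all_cat => /andP[tG _] tight_tau.
  have [-> -> -> eqG] := IH _ _ _ _ _ Gt tG tight_tau.
  have M0 : M = [::] := eqG 0 isT.
  have [E0 -> -> ->] := mtyping_nil Ep (congr1 size M0).
  rewrite M0; split=> //=; first by lia.
  move=> y ne_yx; apply: size0nil.
  by rewrite -(meq_size (GE y)) /cunion E0 cats0 [G1 y](eqG y.+1).
Qed.

(** The head variable is bound by an abstraction of the spine, where (fun_r) supplies the tightness
    of its multiset; nothing else is in use, so the context is empty. *)
Lemma normal_sharp_tight t : normal_sharp t ->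
  forall G b e r tau, typing G b e r t tau -> is_tight tau ->
  [/\ b = 0, e = 0, r = size_lhd t & forall y, G y = [::]].
Proof.
elim=> {t} [t nt|t _ IH|t p _ IH] G b e r tau.
- case/typing_inv=> [[M [sigma [b1 [e1 [r1 [eqt _]]]]]]|].
    by rewrite -(teq_is_tight eqt).
  move=> [M [c [r1 [Mt tM -> ->]]]] _.
  have [-> -> -> eqG] := normal_var_tight nt Mt tM isT.
  by split; rewrite ?addn1 // => y; apply: (eqG y.+1).
- case/typing_inv=> [[M [sigma [b1 [e1 [r1 [eqt _]]]]]]|].
    by rewrite -(teq_is_tight eqt).
  move=> [M [c [r1 [Mt tM -> ->]]]] _.
  have [-> -> -> eqG] := IH _ _ _ _ _ Mt isT.
  by split; rewrite ?addn1 // => y; apply: (eqG y.+1).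
- move=> /typing_inv
    [G1 [E [M [b1 [e1 [r1 [b2 [e2 [r2 [[GE Gt Ep] [-> -> ->]]]]]]]]]]] tight_tau.
  have [-> -> -> eqG] := IH _ _ _ _ _ Gt tight_tau.
  have M0 : M = [::] := eqG 0.
  have [E0 -> -> ->] := mtyping_nil Ep (congr1 size M0).
  rewrite M0; split=> //=; first by lia.
  move=> y; apply: size0nil.
  by rewrite -(meq_size (GE y)) /cunion E0 cats0 [G1 y](eqG y.+1).
Qed.

End Typing.

(** * Shape of normal forms and progress *)

Lemma abs_lhd_dec t : abs_lhd t \/ ~ abs_lhd t.
Proof.
elim: t => [x|t _|t _ p _|t IH p _].
- by right=> abs_x; inversion abs_x.
- by left; constructor.
- by right=> abs_tp; inversion abs_tp.
- case: IH => [abs_t|not_abs]; first by left; constructor.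
  by right=> abs_tp; inversion abs_tp.
Qed.

(** Generalizes the side condition of [step_ES] from 0 to any [x], since the index grows under
    binders. At [x = 0] the two forms are convertible. *)
Definition head_form x t := exists H, t = hplug H (Var (x + hdepth H)).

(** [progress] splits on this to decide between [step_e] and the negative side condition of
    [step_ES], without classical logic. *)
Lemma head_form_dec t x : head_form x t \/ ~ head_form x t.
Proof.
elim: t x => [y|t IH|t IH p _|t IH p _] x.
- have [->|/eqP ne_yx] := eqVneq y x.
    by left; exists HHole; rewrite addn0.
  by right=> [[[|H|H p|H p] //= [eq_yx]]]; apply: ne_yx; rewrite eq_yx addn0.
- case: (IH x.+1) => [[H ->]|nH].
    by left; exists (HLam H); rewrite /= addnS.
  by right=> [[[|H|H p|H p] //= [eqt]]]; apply: nH; exists H; rewrite eqt addnS.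
- case: (IH x) => [[H ->]|nH]; first by left; exists (HApp H p).
  by right=> [[[|H|H q|H q] //= [eqt _]]]; apply: nH; exists H.
- case: (IH x.+1) => [[H ->]|nH].
    by left; exists (HES H p); rewrite /= addnS.
  by right=> [[[|H|H q|H q] //= [eqt _]]]; apply: nH; exists H; rewrite eqt addnS.
Qed.

Lemma neutral_var_head x t : neutral_var x t -> head_form x t.
Proof.
elim=> {x t} [x|x t p _ [H ->]|x t p _ [H ->]].
- by exists HHole; rewrite addn0.
- by exists (HApp H p).
- by exists (HES H p); rewrite /= addnS.
Qed.

Lemma normal_var_head x t : normal_var x t -> head_form x t.
Proof.
elim=> {x t} [x t /neutral_var_head //|x t _ [H ->]|x t p _ [H ->]].
- by exists (HLam H); rewrite /= addnS.
- by exists (HES H p); rewrite /= addnS.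
Qed.

(** Once abstractions are ruled out, a normal form is neutral: this serves both the function part of
    an application and the final claim on type [Neutral]. *)
Lemma normal_var_abs x t : normal_var x t -> neutral_var x t \/ abs_lhd t.
Proof.
elim=> {x t} [x t|x t _ _|x t p _ [nt|abs_t]]; try by left.
- by right; constructor.
- by left; constructor.
- by right; constructor.
Qed.

Lemma normal_sharp_abs t : normal_sharp t -> abs_lhd t.
Proof. by elim=> *; constructor. Qed.

Lemma abs_lhdP t : abs_lhd t -> exists L u, t = splug L (Lam u).
Proof.
elim=> {t} [t|t p _ [L [u ->]]]; first by exists SHole, t.
by exists (SES L p), u.
Qed.

Lemma progress t : normal_lhd t \/ exists u, step t u.
Proof.
elim: t => [x|t IH|t IH p _|t IH p _].
- by left; left; exists x; do 2!constructor.
- case: IH => [[[[|x] nt]|nt]|[u tu]].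
  (* The head variable of the body is the one bound here, so the abstraction becomes a closed-head
     normal form. *)
  + by left; right; constructor.
  + by left; left; exists x; constructor.
  + by left; right; apply: sharp_Lam.
  + by right; exists (Lam u); constructor.
- have [/abs_lhdP [L [u ->]]|not_abs] := abs_lhd_dec t.
    by right; eexists; apply: step_m.
  case: IH => [[[x /normal_var_abs [nt|//]]|/normal_sharp_abs //]|[u tu]].
    by left; left; exists x; do 2!constructor.
  by right; exists (App u p); constructor.
- have [[H ->]|not_head] := head_form_dec t 0.
    by right; eexists; apply: (step_e H).
  case: IH => [[[[|x] nt]|nt]|[u tu]].
  (* A normal body whose head variable is 0 would be an exponential redex, already treated. *)
  + by case: not_head; apply: normal_var_head.
  + by left; left; exists x; apply: normal_ES.
  + by left; right; constructor.
  + by right; exists (ES u p); constructor.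
Qed.

(** * Reduction to normal form with exact counts *)

Theorem theorem6p7 (A : Type) (A_nonempty : inhabited A)
    (G : ctx A) (b e r : nat) (t : term) (tau : ty A)
    (Phi : typing G b e r t tau)
    (tight_G : is_tight_ctx G) (tight_tau : is_tight tau) :
  ~~ odd b /\
  exists p : term,
    [/\ steps (b./2 + e) t p,
        normal_lhd p,
        size_lhd p = r
      & tau = Tight Neutral -> neutral_lhd p].
Proof.
(* The sum [b + e] drops by 2 or by 1 at each step, while [G], [tau] and r stay fixed. *)
have [n le_n] := ubnP (b + e); elim: n => // n IH in b e t Phi le_n *.
have [nt|[u tu]] := progress t.
  have [-> -> ->] : [/\ b = 0, e = 0 & r = size_lhd t].
    case: nt => [[x nt]|nt].
      by have [] := normal_var_tight nt Phi (tight_G x) tight_tau.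
    by have [] := normal_sharp_tight nt Phi tight_tau.
  split=> //; exists t; split=> // tauN; rewrite tauN in Phi.
  case: nt => [[x /normal_var_abs [nt|abs_t]]|/normal_sharp_abs abs_t].
  - by exists x.
  - by case: (abs_lhd_not_neutral abs_t Phi).
  - by case: (abs_lhd_not_neutral abs_t Phi).
have [b' [e' [Gu eqs]]] := subject_reduction tu Phi.
have [|evenb' [p [st np sp ntr]]] := IH _ _ _ Gu; first by lia.
(* A step changes b by 2 or 0, so the parity found at the normal form travels back. *)
split; first by case: eqs => [[-> _]|[-> _]]; rewrite //= negbK.
exists p; split=> //.
(* Either kind of step lowers [b./2 + e] by exactly 1. *)
have -> : b./2 + e = (b'./2 + e').+1.
  by case: eqs => [[-> ->]|[-> ->]]; rewrite ?addnS.
by exists u.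
Qed.
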